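(* Let $d$ be even. For any integers $r,n_0,n_1\ge0$ such that $s=r+n_0+n_1\le d/2$, $$c(r,n_0,n_1)\ge c_+(r,n_0,n_1)>c(0,0,s)=\frac{d/2-s}{d/2+1-s}.$$ In particular, $c_+(d/2-1,0,0)>\tfrac12$.
   Context: Let $d\ge2$ be even. Vectors in $\mathbb{R}^{d+1}$ have coordinates indexed $0,\dots,d$ and are written $(x_0,x)$. Let $K=\{(x_0,x)\in\mathbb{R}^{d+1}: \sum_{i\in S}x_i\le\frac d2x_0\text{ for all }S\subset\{1,\dots,d\}\text{ with }|S|=\frac d2+1,\ 0\le x\le x_0e\}$. $Q$ is the convex cone generated by all $(1,x)$, $x\in\{0,1\}^d$; $C^*=\{s:s^Tx\ge0\ \forall x\in C\}$. For a convex cone $K'\subseteq Q$: $M(K')$ is the set of real symmetric $(d+1)\times(d+1)$ matrices $Y$ with $Ye_0=\mathrm{diag}(Y)$ and $u^TYv\ge0$ for all $u\in Q^*,v\in K'^*$; $M_+(K')$ its positive semidefinite members; $N(K')=\{\mathrm{diag}(Y):Y\in M(K')\}$, $N_+(K')=\{\mathrm{diag}(Y):Y\in M_+(K')\}$; $N^0=N_+^0=\mathrm{id}$, $N^r(K')=N(N^{r-1}(K'))$, $N_+^r(K')=N_+(N_+^{r-1}(K'))$. For integers $r,n_0,n_1\ge0$ with $n_0+n_1<d$, $c(r,n_0,n_1)$ is the largest $\alpha\in\mathbb{R}$ such that $(1,x)\in N^r(K)$, where $x$ has $n_1$ coordinates equal to $1$, $n_0$ coordinates equal to $0$ and the remaining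 $d-n_0-n_1$ coordinates equal to $\alpha$ (by symmetry of $K$ the choice of positions is immaterial); $c_+(r,n_0,n_1)$ is defined in the same way with $N_+^r(K)$ in place of $N^r(K)$.
   Formalization: The strict inequality c_+(r,n_0,n_1) > c(0,0,s) is claimed only when r+n_0 > 0 (for r = n_0 = 0 the two sides are equal, and ≥ is stated); the final claim c_+(d/2-1,0,0) > 1/2 is stated only for d > 2, since for d = 2 the value is exactly 1/2. *)

(* Defs.v *)
From HB Require Import structures.
From mathcomp Require Import all_boot all_order all_algebra.
From mathcomp Require Import all_classical all_reals.

Set Implicit Arguments.
Unset Strict Implicit.
Unset Printing Implicit Defensive.

Import Order.TTheory GRing.Theory Num.Theory.

Local Open Scope classical_set_scope.
Local Open Scope ring_scope.

(* Vectors of R^(d+1) are written (x_0, x), with x_0 in R and x in R^d; they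
   are block columns of type 'cV_(1 + d), so the coordinate 0 is the upper block
   and the coordinates 1, ..., d are indexed by 'I_d in the lower block. *)
Definition hvec (R : realType) (d : nat) (x0 : R) (x : 'cV[R]_d) :
    'cV[R]_(1 + d) :=
  col_mx x0%:M x.

Definition e0 (R : realType) (d : nat) : 'cV[R]_(1 + d) := hvec 1 0.

(* Convex cone generated by A; the empty combination makes 0 a member. *)
Definition cone (R : realType) (n : nat) (A : set 'cV[R]_n) : set 'cV[R]_n :=
  [set x | exists (k : nat) (a : 'I_k -> R) (v : 'I_k -> 'cV[R]_n),
     [/\ forall i, 0 <= a i, forall i, A (v i) & x = \sum_(i < k) a i *: v i]].

Definition dual (R : realType) (n : nat) (C : set 'cV[R]_n) : set 'cV[R]_n :=
  [set s | forall x, C x -> 0 <= (s^T *m x) 0 0].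

Definition Q (R : realType) (d : nat) : set 'cV[R]_(1 + d) :=
  cone [set hvec 1 x | x in [set x : 'cV[R]_d |
                               forall i, x i 0 = 0 \/ x i 0 = 1]].

Definition diagc (R : realType) (n : nat) (Y : 'M[R]_n) : 'cV[R]_n :=
  \col_i Y i i.

Definition psd (R : realType) (n : nat) (Y : 'M[R]_n) : Prop :=
  forall v : 'cV[R]_n, 0 <= (v^T *m Y *m v) 0 0.

Definition M (R : realType) (d : nat) (C : set 'cV[R]_(1 + d)) :
    set 'M[R]_(1 + d) :=
  [set Y | [/\ Y^T = Y, Y *m e0 R d = diagc Y &
     forall u v, dual (@Q R d) u -> dual C v -> 0 <= (u^T *m Y *m v) 0 0]].

Definition Mplus (R : realType) (d : nat) (C : set 'cV[R]_(1 + d)) :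
    set 'M[R]_(1 + d) :=
  [set Y | M C Y /\ psd Y].

Definition N (R : realType) (d : nat) (C : set 'cV[R]_(1 + d)) :
    set 'cV[R]_(1 + d) :=
  [set diagc Y | Y in M C].

Definition Nplus (R : realType) (d : nat) (C : set 'cV[R]_(1 + d)) :
    set 'cV[R]_(1 + d) :=
  [set diagc Y | Y in Mplus C].

Definition K (R : realType) (d : nat) : set 'cV[R]_(1 + d) :=
  [set z | exists (x0 : R) (x : 'cV[R]_d),
     [/\ z = hvec x0 x,
         forall S : {set 'I_d}, #|S| = (d./2).+1 ->
           \sum_(i in S) x i 0 <= (d./2)%:R * x0 &
         forall i, 0 <= x i 0 <= x0]].

(* K, hence every iterate of N or Nplus on K, is invariant under permutations
   of the coordinates 1, ..., d, so the ones and zeros are put first. *)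
Definition pt (R : realType) (d n0 n1 : nat) (a : R) : 'cV[R]_d :=
  \col_(i < d) (if (i < n1)%N then 1 else if (i < n1 + n0)%N then 0 else a).

(* The greatest element of A, and 0 (a junk value) if there is none. *)
Definition largest (R : realType) (A : set R) : R :=
  xget 0 [set a | A a /\ ubound A a].

(* Meaningful when n0 + n1 < d: otherwise no coordinate is equal to a. *)
Definition c (R : realType) (d r n0 n1 : nat) : R :=
  largest [set a | iter r (@N R d) (@K R d) (hvec 1 (pt d n0 n1 a))].

Definition cplus (R : realType) (d r n0 n1 : nat) : R :=
  largest [set a | iter r (@Nplus R d) (@K R d) (hvec 1 (pt d n0 n1 a))].

(* Main.v *)
Require Import Defs.
From HB Require Import structures.
From mathcomp Require Import all_boot all_order all_algebra.
From mathcomp Require Import all_classical all_reals.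
From mathcomp Require Import topology normedtype derive.
From mathcomp Require Import ring lra.

Set Implicit Arguments.
Unset Strict Implicit.

Import Order.TTheory GRing.Theory Num.Theory.
Import numFieldNormedType.Exports.
Local Open Scope classical_set_scope.
Local Open Scope ring_scope.

(* Fix s = r + n0 + n1 and b = c(0,0,s).  By induction on r, for every a in some
   interval [b, a0], the point x with n1 ones, n0 zeros and the other
   coordinates equal to a lies in N_+^r(K), with a0 > b as soon as r + n0 > 0.
   In the inductive step, for a slightly above b, take Y with Y e_i = a (1, x')
   and Y (e_0 - e_i) = (1 - a) (1, x'') for each free coordinate i, where x' has
   a one at i and b at the other free coordinates, and x'' has a zero at i and
   g = a (1 - b) / (1 - a) at the other free coordinates.  The point x' is
   provided by the induction hypothesis for (r - 1, n0, n1 + 1); the one for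
   (r - 1, n0 + 1, n1) is strict, so it still covers g, which tends to b with a.
   Finally Y is positive semidefinite for a near b, because b < 1.
   That the largest value is attained follows from compactness of
   {Y in M(C) : Y_00 = 1}, on which all entries of Y lie in [0, 1]. *)

(** * Duality and the operators N and N_+ *)

Lemma hvecE0 (R : realType) d x0 (x : 'cV[R]_d) i : hvec x0 x (lshift d i) 0 = x0.
Proof. by rewrite /hvec col_mxEu ord1 mxE eqxx. Qed.

Lemma hvecES (R : realType) d x0 (x : 'cV[R]_d) i :
  hvec x0 x (rshift 1 i) 0 = x i 0.
Proof. by rewrite /hvec col_mxEd. Qed.

Lemma dot_split (R : realType) d (u g : 'cV[R]_(1 + d)) :
  (u^T *m g) 0 0 = u (lshift d 0) 0 * g (lshift d 0) 0 +
    \sum_i u (rshift 1 i) 0 * g (rshift 1 i) 0.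
Proof.
rewrite mxE big_split_ord /= big_ord1; congr (_ + _); first by rewrite !mxE.
by apply: eq_bigr => i _; rewrite !mxE.
Qed.

Lemma dotC (R : realType) n (u v : 'cV[R]_n) : (u^T *m v) 0 0 = (v^T *m u) 0 0.
Proof. by rewrite -{1}(trmxK v) -trmx_mul mxE. Qed.

(** The homogenised unit cube. Its inequalities stand in for the generators of [Q], and for d > 0
    they bound every iterate of [N] and [Nplus] on [K]. *)
Definition box (R : realType) (d : nat) : set 'cV[R]_(1 + d) :=
  [set z | forall k, 0 <= z k 0 <= z (lshift d 0) 0].

Lemma Q_hvec (R : realType) d (x : 'cV[R]_d) :
  (forall i, x i 0 = 0 \/ x i 0 = 1) -> Q (hvec 1 x).
Proof.
move=> x01; exists 1%N, (fun=> 1), (fun=> hvec 1 x); split=> // [_|].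
  by exists x.
by rewrite big_ord1 scale1r.
Qed.

Lemma cone_box (R : realType) d (A : set 'cV[R]_(1 + d)) :
  (A `<=` @box R d) -> (cone A `<=` @box R d).
Proof.
move=> AB z [k [a [v [a0 Av ->]]]] j; rewrite !summxE.
apply/andP; split.
  apply: sumr_ge0 => i _; rewrite mxE mulr_ge0 //.
  by have /andP[] := AB _ (Av i) j.
apply: ler_sum => i _; rewrite !mxE ler_wpM2l //.
by have /andP[] := AB _ (Av i) j.
Qed.

Lemma Q_box (R : realType) d : (@Q R d `<=` @box R d).
Proof.
apply: cone_box => _ [x x01 <-] k.
rewrite hvecE0; case: (split_ordP k) => j ->; rewrite ?hvecE0 ?hvecES.
  by rewrite ler01 lexx.
by case: (x01 j) => ->; rewrite ?ler01 ?lexx.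
Qed.

(* Minimising u^T g over g in the box picks the 0/1 vector supported on the
   negative entries of u, so the box is contained in the bidual of Q. *)
Lemma dualQ_box (R : realType) d (u g : 'cV[R]_(1 + d)) :
  dual (@Q R d) u -> box g -> 0 <= (u^T *m g) 0 0.
Proof.
move=> uQ gB.
pose x : 'cV[R]_d := \col_i (u (rshift 1 i) 0 < 0)%R%:R.
have /uQ : Q (hvec 1 x).
  by apply: Q_hvec => i; rewrite mxE; case: (_ < _); [right|left].
move=> ux; rewrite dot_split hvecE0 mulr1 in ux; rewrite dot_split.
have g0 : 0 <= g (lshift d 0) 0 by have /andP[] := gB (lshift d 0).
apply: (@le_trans _ _ ((u (lshift d 0) 0 + \sum_i u (rshift 1 i) 0 *
    hvec 1 x (rshift 1 i) 0) * g (lshift d 0) 0)); first by rewrite mulr_ge0.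
rewrite mulrDl lerD2l mulr_suml; apply: ler_sum => i _.
rewrite hvecES mxE -mulrA; have /andP[gi0 gi] := gB (rshift 1 i).
case: ltP => ui; first by rewrite mul1r ler_wnM2l // ltW.
by rewrite mul0r mulr0 mulr_ge0.
Qed.

Lemma mul_e0 (R : realType) d (Y : 'M[R]_(1 + d)) :
  Y *m e0 R d = col (lshift d 0) Y.
Proof.
apply/matrixP => i j; rewrite ord1 !mxE big_split_ord /= big_ord1 hvecE0.
by rewrite mulr1 big1 ?addr0 // => k _; rewrite hvecES mxE mulr0.
Qed.

(** Tested against [v] in [dual C], the last two hypotheses say that [Y *m v] lies in the box, and
    [dualQ_box] concludes. Membership in the bidual is enough, and the bidual is stable under sums
    and nonnegative multiples for any [C]. *)
Lemma M_intro (R : realType) d (C : set 'cV[R]_(1 + d)) (Y : 'M[R]_(1 + d)) :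
  Y^T = Y -> col (lshift d 0) Y = diagc Y ->
  (forall k, dual (dual C) (col k Y)) ->
  (forall k, dual (dual C) (col (lshift d 0) Y - col k Y)) ->
  M C Y.
Proof.
move=> YT Y0 C1 C2; split => //; first by rewrite mul_e0.
move=> u v uQ vC; rewrite -mulmxA; apply: dualQ_box => // k.
have E j : (Y *m v) j 0 = ((col j Y)^T *m v) 0 0.
  by rewrite tr_col YT -row_mul !mxE.
have := C1 k v vC; have := C2 k v vC; rewrite !E linearB /= mulmxBl !mxE.
by rewrite subr_ge0 => -> ->.
Qed.

Lemma dual_dual (R : realType) n (C : set 'cV[R]_n) w : C w -> dual (dual C) w.
Proof. by move=> Cw v vC; rewrite dotC; apply: vC. Qed.

Lemma dualZ (R : realType) n (C : set 'cV[R]_n) a w :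
  0 <= a -> dual C w -> dual C (a *: w).
Proof.
move=> a0 Cw v vC; rewrite linearZ /= -scalemxAl mxE mulr_ge0 //; exact: Cw.
Qed.

Lemma dualD (R : realType) n (C : set 'cV[R]_n) v w :
  dual C v -> dual C w -> dual C (v + w).
Proof.
move=> Cv Cw x xC; rewrite linearD /= mulmxDl mxE addr_ge0 //;
  [exact: Cv|exact: Cw].
Qed.

Lemma dual_mono (R : realType) n (C D : set 'cV[R]_n) :
  (C `<=` D) -> (dual D `<=` dual C).
Proof. by move=> CD s sD x /CD; apply: sD. Qed.

Lemma N_mono (R : realType) d (C D : set 'cV[R]_(1 + d)) :
  (C `<=` D) -> (N C `<=` N D).
Proof.
move=> CD _ [Y [YT Y0 YC] <-]; exists Y => //; split=> // u v uQ vD.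
by apply: YC => //; apply: dual_mono vD.
Qed.

Lemma Nplus_sub_N (R : realType) d (C : set 'cV[R]_(1 + d)) :
  (Nplus C `<=` N C).
Proof. by move=> _ [Y [YM _] <-]; exists Y. Qed.

Lemma iter_Nplus_sub (R : realType) d r :
  (iter r (@Nplus R d) (@K R d) `<=` iter r (@N R d) (@K R d)).
Proof.
elim: r => // r IH; rewrite !iterS => z /Nplus_sub_N; exact: N_mono.
Qed.

Lemma dual_basis_box (R : realType) d (C : set 'cV[R]_(1 + d)) k :
  (C `<=` @box R d) ->
  dual C (delta_mx k 0) /\ dual C (delta_mx (lshift d 0) 0 - delta_mx k 0).
Proof.
move=> CB; split=> z /CB /(_ k) /andP[z0 z1].
  by rewrite trmx_delta -rowE mxE.
by rewrite linearB /= !trmx_delta mulmxBl -!rowE !mxE subr_ge0.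
Qed.

(** The inequalities come from the test pairs (e_k, e_l), (e_0 - e_k, e_l) and (e_0 - e_l, e_0). On
    the slice Y_00 = 1 they confine all entries to [0, 1]. *)
Lemma M_entry (R : realType) d (C : set 'cV[R]_(1 + d)) Y k l :
  (C `<=` @box R d) -> M C Y ->
  [/\ Y l (lshift d 0) = Y l l, 0 <= Y k l, Y k l <= Y l l
    & Y l l <= Y (lshift d 0) (lshift d 0)].
Proof.
move=> CB [YT Y0 YC].
have YS i j : Y i j = Y j i by rewrite -{1}YT mxE.
have E i j : ((delta_mx i 0 : 'cV[R]_(1+d))^T *m Y *m (delta_mx j 0 : 'cV[R]_(1+d))) 0 0 = Y i j.
  by rewrite trmx_delta -rowE -colE !mxE.
have B (a b w : 'cV[R]_(1 + d)) : ((a - b)^T *m Y *m w) 0 0 =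
    (a^T *m Y *m w) 0 0 - (b^T *m Y *m w) 0 0.
  by rewrite linearB /= !mulmxBl mxE [X in _ + X]mxE.
have [Q1 Q2] := @dual_basis_box R d (@Q R d) k (@Q_box R d).
have [L1 L2] := @dual_basis_box R d (@Q R d) l (@Q_box R d).
have [C1 C2] := @dual_basis_box R d C l CB.
have [Z1 _] := @dual_basis_box R d C (lshift d 0) CB.
have D i : Y i (lshift d 0) = Y i i.
  by have /matrixP/(_ i 0) := Y0; rewrite mul_e0 !mxE.
split=> //; first by have := YC _ _ Q1 C1; rewrite E.
  have := YC _ _ Q2 C1.
  by rewrite B !E -(D l) (YS l) subr_ge0.
have := YC _ _ L2 Z1; by rewrite B !E D subr_ge0.
Qed.

(** * Attainment of the largest value *)

Lemma closed_forall (T : topologicalType) J (P : J -> T -> Prop) :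
  (forall i, closed [set v | P i v]) -> closed [set v | forall i, P i v].
Proof.
move=> Pc; have -> : [set v | forall i, P i v] = (\bigcap_i [set v | P i v]).
  by apply/seteqP; split=> v Pv i; [move=> _; exact: Pv|exact: (Pv i I)].
exact: closed_bigI.
Qed.

Lemma closed_imply (T : topologicalType) (A : Prop) (P : T -> Prop) :
  closed [set v | P v] -> closed [set v | A -> P v].
(* An implication is a universal quantification over the proofs of [A]. *)
Proof. by move=> Pc; apply: (@closed_forall T A (fun=> P)). Qed.

Lemma closed_nonneg (R : realType) (T : topologicalType) (f : T -> R) :
  continuous f -> closed [set v | 0 <= f v].
Proof.
by move=> fc; apply: (@preimage_closed T R f _ _ (@closed_ge R 0)) => x _; exact: fc.
Qed.

Lemma closed_eq_fun (R : realType) (T : topologicalType) (f g : T -> R) :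
  continuous f -> continuous g -> closed [set v | f v = g v].
Proof.
move=> fc gc.
have -> : [set v | f v = g v] = ((f \- g) @^-1` [set x | x = 0]).
  by apply/seteqP; split=> v /= => [->|/eqP]; rewrite ?subrr // subr_eq0 => /eqP.
apply: preimage_closed; last exact: closed_eq.
by move=> x _; apply: continuousB; [exact: fc|exact: gc].
Qed.

Lemma continuous_sumr (R : realType) (T : topologicalType) I (r : seq I)
    (f : I -> T -> R) :
  (forall i, continuous (f i)) -> continuous (fun v => \sum_(i <- r) f i v).
Proof.
move=> fc; elim: r => [|i r IH].
  rewrite (_ : (fun _ => _) = fun=> 0); first exact: cst_continuous.
  by apply/funext => v; rewrite big_nil.
rewrite (_ : (fun _ => _) = f i \+ (fun v => \sum_(i <- r) f i v)); last first.
  by apply/funext => v; rewrite big_cons.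
by move=> x; apply: continuousD; [exact: fc|exact: IH].
Qed.

(** Matrices are flattened to row vectors, so that compactness can be taken from [rV_compact]. *)
Lemma vec_mx_continuous (R : realType) m n i j :
  continuous (fun v : 'rV[R]_(m * n) => (vec_mx v : 'M_(m, n)) i j).
Proof.
rewrite (_ : (fun _ => _) = fun v : 'rV[R]_(m * n) => v 0 (mxvec_index i j)).
  exact: coord_continuous.
by apply/funext => v; rewrite mxE.
Qed.

Lemma bilin_continuous (R : realType) n (a b : 'cV[R]_n) :
  continuous (fun v : 'rV[R]_(n * n) => (a^T *m vec_mx v *m b) 0 0).
Proof.
rewrite (_ : (fun _ => _) = fun v : 'rV[R]_(n * n) =>
   \sum_l \sum_k a k 0 * b l 0 * vec_mx v k l); last first.
  apply/funext => v; rewrite mxE; apply: eq_bigr => l _.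
  rewrite mxE mulr_suml; apply: eq_bigr => k _.
  by rewrite [a^T _ _]mxE mulrAC.
apply: continuous_sumr => l; apply: continuous_sumr => k x.
apply: (@continuousM R _ (fun=> a k 0 * b l 0)
  (fun v : 'rV[R]_(n * n) => (vec_mx v : 'M_n) k l)); first exact: cst_continuous.
exact: vec_mx_continuous.
Qed.

(** The bound 0 <= x_0 is read off at one coordinate of x; for d = 0 there is none, and x_0 could be
    negative. *)
Lemma K_box (R : realType) d : (0 < d)%N -> (@K R d `<=` @box R d).
Proof.
case: d => // d _ z [x0 [x [-> _ x01]]] k; rewrite hvecE0.
case: (split_ordP k) => j ->; rewrite ?hvecE0 ?hvecES // lexx andbT.
by have /andP[] := x01 ord0; apply: le_trans.
Qed.

Lemma N_box (R : realType) d (C : set 'cV[R]_(1 + d)) :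
  (C `<=` @box R d) -> (N C `<=` @box R d).
Proof.
move=> CB _ [Y YM <-] k; rewrite !mxE.
by have [_ -> _ ->] := M_entry k k CB YM.
Qed.

Lemma iter_N_box (R : realType) d r : (0 < d)%N ->
  (iter r (@N R d) (@K R d) `<=` @box R d).
Proof.
by move=> d0; elim: r => [|r IH]; [exact: K_box|exact: N_box].
Qed.

Lemma iter_Nplus_box (R : realType) d r : (0 < d)%N ->
  (iter r (@Nplus R d) (@K R d) `<=` @box R d).
Proof. move=> d0 z /iter_Nplus_sub; exact: iter_N_box. Qed.

(** Each symmetry, diagonal or dual-pair condition is closed in Y, whatever [C] is; hence no iterate
    has to be shown closed. *)
Lemma closed_M (R : realType) d (C : set 'cV[R]_(1 + d)) :
  closed [set v : 'rV[R]_((1 + d) * (1 + d)) | M C (vec_mx v)].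
Proof.
have -> : [set v : 'rV[R]_((1 + d) * (1 + d)) | M C (vec_mx v)] =
  ([set v : 'rV[R]_((1 + d) * (1 + d)) | forall i j, vec_mx v i j = vec_mx v j i] `&`
  ([set v : 'rV[R]_((1 + d) * (1 + d)) | forall i, vec_mx v i (lshift d 0) = vec_mx v i i] `&`
  [set v : 'rV[R]_((1 + d) * (1 + d)) | forall a b, dual (@Q R d) a -> dual C b ->
     0 <= (a^T *m vec_mx v *m b) 0 0])).
  apply/seteqP; split=> v /=.
    case=> [vT v0 vQ]; split; [|split] => //.
      by move=> i j; rewrite -[in LHS]vT mxE.
    by move=> i; have /matrixP/(_ i 0) := v0; rewrite mul_e0 !mxE.
  case=> vT [v0 vQ]; split=> //.
    by apply/matrixP=> i j; rewrite mxE vT.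
  by rewrite mul_e0; apply/matrixP=> i j; rewrite [LHS]mxE v0 [RHS]mxE.
apply: closedI; last apply: closedI.
- apply: closed_forall => i; apply: closed_forall => j.
  by apply: closed_eq_fun; exact: vec_mx_continuous.
- apply: closed_forall => i.
  by apply: closed_eq_fun; exact: vec_mx_continuous.
- apply: closed_forall => a; apply: closed_forall => b.
  by do 2!apply: closed_imply; apply: closed_nonneg; exact: bilin_continuous.
Qed.

Lemma closed_psd (R : realType) n :
  closed [set v : 'rV[R]_(n * n) | psd (vec_mx v)].
Proof.
by apply: closed_forall => a; apply: closed_nonneg; exact: bilin_continuous.
Qed.

Lemma M_slice_compact (R : realType) d (C : set 'cV[R]_(1 + d)) :
  (C `<=` @box R d) ->
  compact [set v : 'rV[R]_((1 + d) * (1 + d)) |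
    M C (vec_mx v) /\ vec_mx v (lshift d 0) (lshift d 0) = 1].
Proof.
move=> CB.
apply: (@subclosed_compact _ _
  [set v : 'rV[R]_((1 + d) * (1 + d)) | forall i, [set` `[0, 1]] (v ord0 i)]).
- apply: closedI; first exact: closed_M.
  by apply: closed_eq_fun; [exact: vec_mx_continuous|exact: cst_continuous].
- apply: (@rV_compact R _ (fun=> [set` `[0, 1]])) => i; exact: segment_compact.
- move=> v /= [vM v1] i; case/mxvec_indexP: i => i j.
  have -> : v ord0 (mxvec_index i j) = vec_mx v i j by rewrite mxE.
  rewrite in_itv /=; have [e0 e1 e2 e3] := M_entry i j CB vM.
  by rewrite e1 (le_trans e2) // -v1.
Qed.

Lemma largestP (R : realType) (A : set R) :
  (exists m, A m /\ ubound A m) -> A (largest A) /\ ubound A (largest A).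
Proof. by move=> Am; apply: (xgetPex 0 Am). Qed.

Lemma largest_eq (R : realType) (A : set R) m :
  A m -> ubound A m -> largest A = m.
Proof.
move=> Am mA; have [Al lA] : A (largest A) /\ ubound A (largest A).
  by apply: largestP; exists m.
by apply/le_anti/andP; split; [exact: mA|exact: lA].
Qed.

Lemma compact_has_largest (R : realType) (T : topologicalType) (A : set T)
    (f : T -> R) : compact A -> continuous f -> A !=set0 ->
  exists m, [set f x | x in A] m /\ ubound [set f x | x in A] m.
Proof.
move=> Ac fc A0.
have [x xA fx] := compact_EVT_max A0 Ac (continuous_subspaceT fc).
exists (f x); split; first by exists x => //; exact/set_mem.
by move=> _ [y yA <-]; apply: fx; exact/mem_set.
Qed.

Lemma pt_last (R : realType) d n0 n1 (a : R) (j : 'I_d) :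
  (n1 + n0 <= j)%N -> pt d n0 n1 a j 0 = a.
Proof.
move=> nj; rewrite mxE !ltnNge nj (leq_trans _ nj) //; exact: leq_addr.
Qed.

Lemma pt_continuous (R : realType) (T : topologicalType) (f : T -> R) d n0 n1 i :
  continuous f -> continuous (fun v => pt d n0 n1 (f v) i 0).
Proof.
move=> fc; rewrite (_ : (fun _ => _) = fun v =>
  if (i < n1)%N then 1 else if (i < n1 + n0)%N then 0 else f v); last first.
  by apply/funext => v; rewrite mxE.
case: (i < n1)%N; first exact: cst_continuous.
by case: (i < n1 + n0)%N; first exact: cst_continuous.
Qed.

Lemma K_hvecE (R : realType) d (x0 : R) (x : 'cV[R]_d) :
  K (hvec x0 x) <->
  (forall S : {set 'I_d}, #|S| = (d./2).+1 ->
     \sum_(i in S) x i 0 <= (d./2)%:R * x0) /\ (forall i, 0 <= x i 0 <= x0).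
Proof.
split=> [[y0 [y [/eq_col_mx[e0 ->] yS yb]]]|[xS xb]]; last by exists x0, x.
have -> : x0 = y0 by have /matrixP/(_ 0 0) := e0; rewrite !mxE eqxx.
by [].
Qed.

(** The case r = 0, where no matrix Y is at hand: the admissible [a] form a closed subset of [0, 1],
    since [a] is itself a coordinate of the point. *)
Lemma K_has_largest (R : realType) d n0 n1 : (n1 + n0 < d)%N ->
  let A := [set a | K (hvec 1 (pt d n0 n1 a) : 'cV[R]_(1 + d))] in
  A !=set0 -> exists m, A m /\ ubound A m.
Proof.
move=> nd A A0.
suff Ac : compact A.
  have ic : continuous (@id R) by move=> x; exact: cvg_id.
  by have := compact_has_largest Ac ic A0; rewrite image_id.
apply: (@subclosed_compact R A [set` `[0, 1]]).
2: exact: segment_compact.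
2: move=> a /K_hvecE[_ /(_ (Ordinal nd))].
2: by rewrite pt_last //= in_itv.
have -> : A = [set a | forall S : {set 'I_d}, #|S| = (d./2).+1 ->
    0 <= (d./2)%:R * 1 - \sum_(i <- enum S) pt d n0 n1 a i 0] `&`
    ([set a | forall i, 0 <= pt d n0 n1 a i 0] `&`
     [set a | forall i, 0 <= 1 - pt d n0 n1 a i 0]).
  apply/seteqP; split=> a /=.
    move=> /K_hvecE[aS ab]; split; [|split].
    - by move=> S SC; rewrite subr_ge0 big_enum; exact: aS.
    - by move=> i; have /andP[] := ab i.
    - by move=> i; have /andP[] := ab i; rewrite subr_ge0.
  move=> [aS [a0 a1]]; apply/K_hvecE; split=> [S SC|i].
    by have := aS S SC; rewrite subr_ge0 big_enum.
  by rewrite a0 -subr_ge0 a1.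
have pc i : continuous (fun a : R => pt d n0 n1 a i 0).
  by apply: (@pt_continuous R R id) => x; exact: cvg_id.
apply: closedI; [|apply: closedI].
- apply: closed_forall => S; apply: closed_imply; apply: closed_nonneg => x.
  apply: (@continuousB R R R (fun=> _)
    (fun a => \sum_(i <- enum S) pt d n0 n1 a i 0)); first exact: cst_continuous.
  exact: (@continuous_sumr R R _ (enum S) (fun i a => pt d n0 n1 a i 0)).
- by apply: closed_forall => i; apply: closed_nonneg; exact: pc.
- apply: closed_forall => i; apply: closed_nonneg => x.
  apply: (@continuousB R R R (fun=> _) (fun a => pt d n0 n1 a i 0)).
    exact: cst_continuous.
  exact: pc.
Qed.

(** The admissible [a] are the image of a compact set of matrices under a continuous function. [P]
    will be trivial for [N] and [psd] for [Nplus]. *)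
Lemma M_slice_has_largest (R : realType) d n0 n1 (C : set 'cV[R]_(1 + d))
    (P : set 'M[R]_(1 + d)) : (n1 + n0 < d)%N -> (C `<=` @box R d) ->
  closed [set v : 'rV[R]_((1 + d) * (1 + d)) | P (vec_mx v)] ->
  let A := [set a | [set diagc Y | Y in M C `&` P] (hvec 1 (pt d n0 n1 a))] in
  A !=set0 -> exists m, A m /\ ubound A m.
Proof.
move=> nd CB Pc A A0.
(* The first free coordinate: there the diagonal entry of Y is the parameter [a]. *)
pose j := rshift 1 (Ordinal nd).
pose f (v : 'rV[R]_((1 + d) * (1 + d))) : R := vec_mx v j j.
have fc : continuous f by exact: vec_mx_continuous.
pose B : set 'rV[R]_((1 + d) * (1 + d)) :=
  [set v | M C (vec_mx v) /\ vec_mx v (lshift d 0) (lshift d 0) = 1] `&`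
  ([set v | P (vec_mx v)] `&`
   [set v | forall i, vec_mx v (rshift 1 i) (rshift 1 i) = pt d n0 n1 (f v) i 0]).
have Bc : compact B.
  apply: compact_closedI; first exact: M_slice_compact.
  apply: closedI => //; apply: closed_forall => i; apply: closed_eq_fun.
    exact: vec_mx_continuous.
  exact: pt_continuous.
have AB : A = [set f x | x in B].
  apply/seteqP; split=> a.
    move=> [Y [YM YP] Ya]; exists (mxvec Y); rewrite /f ?mxvecK.
      have Yj i : Y i i = hvec 1 (pt d n0 n1 a) i 0 by rewrite -Ya mxE.
      split; [split|split] => /=; rewrite /f ?mxvecK //; first by rewrite Yj hvecE0.
      by move=> i; rewrite !Yj /j !hvecES (@pt_last _ _ _ _ a (Ordinal nd)).
    by have /matrixP/(_ j 0) := Ya; rewrite hvecES pt_last // mxE.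
  move=> [v [[vM v1] [vP vj]] <-]; exists (vec_mx v); first by [].
  apply/matrixP => i k; rewrite ord1 mxE.
  by case: (split_ordP i) => l ->; rewrite ?hvecES ?hvecE0 ?ord1.
rewrite AB; apply: compact_has_largest => //.
by move: A0; rewrite AB => -[_ [v vB _]]; exists v.
Qed.

(** * The lifting step *)

(** Cauchy-Schwarz against the all-ones vector, from expanding the double sum of (w_i - w_j)^2. *)
Lemma sqr_sum_le (R : realType) n (w : 'I_n -> R) :
  (\sum_i w i) ^+ 2 <= n%:R * \sum_i w i ^+ 2.
Proof.
have : 0 <= \sum_i \sum_j (w i - w j) ^+ 2.
  by apply: sumr_ge0 => i _; apply: sumr_ge0 => j _; exact: sqr_ge0.
have -> : \sum_i \sum_j (w i - w j) ^+ 2 =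
    2 * (n%:R * \sum_i w i ^+ 2 - (\sum_i w i) ^+ 2).
  transitivity (\sum_i (n%:R * w i ^+ 2 + \sum_j w j ^+ 2 - 2 * (w i * \sum_j w j))).
    apply: eq_bigr => i _; rewrite !mulr_sumr.
    rewrite (_ : n%:R * w i ^+ 2 = \sum_(j < n) w i ^+ 2); last first.
      by rewrite sumr_const card_ord mulr_natl.
    rewrite -big_split /= -sumrB; apply: eq_bigr => j _; ring.
  rewrite sumrB big_split /= -!mulr_sumr -mulr_suml sumr_const card_ord -[_ *+ n]mulr_natl.
  ring.
by rewrite pmulr_rge0 ?subr_ge0 // ltr0n.
Qed.

(** The points of [pt] with arbitrary positions: the induction fixes any free coordinate at 0 or 1,
    which does not preserve the order of positions in [pt]. *)
Definition pts (R : realType) d (S0 S1 : {set 'I_d}) (a : R) : 'cV[R]_d :=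
  \col_i (if i \in S1 then 1 else if i \in S0 then 0 else a).

Definition ind (R : realType) d (S0 S1 : {set 'I_d}) : 'cV[R]_d :=
  \col_i ((i \notin S1) && (i \notin S0))%:R.

Lemma ptsE (R : realType) d (S0 S1 : {set 'I_d}) (a : R) i :
  pts S0 S1 a i 0 = if i \in S1 then 1 else if i \in S0 then 0 else a.
Proof. by rewrite mxE. Qed.

Lemma indE (R : realType) d (S0 S1 : {set 'I_d}) i :
  ind R S0 S1 i 0 = ((i \notin S1) && (i \notin S0))%:R.
Proof. by rewrite mxE. Qed.

(* For z = (1, x), t the indicator of the free coordinates, p = a (b - a) and
   q = a (1 - b), this is the matrix Y of the inductive step. *)
Definition lift_mx (R : realType) n (z t : 'cV[R]_n) (p q : R) : 'M[R]_n :=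
  z *m z^T + p *: (t *m t^T) + q *: diag_mx (\row_k t k 0 ^+ 2).

Lemma lift_mxE (R : realType) n (z t : 'cV[R]_n) p q k l :
  lift_mx z t p q k l =
    z k 0 * z l 0 + p * (t k 0 * t l 0) + q * (t k 0 ^+ 2 *+ (k == l)).
Proof. by rewrite !mxE !big_ord1 !mxE. Qed.

Lemma lift_mx_sym (R : realType) n (z t : 'cV[R]_n) p q :
  (lift_mx z t p q)^T = lift_mx z t p q.
Proof.
by rewrite /lift_mx !linearD !linearZ /= !trmx_mul !trmxK tr_diag_mx.
Qed.

(** With w_i = t_i v_i, the form is a square plus p (sum w_i)^2 + q sum w_i^2, and (sum w_i)^2 <= d
    sum w_i^2 lets the diagonal term absorb the negative one. *)
Lemma lift_mx_psd (R : realType) d (z : 'cV[R]_(1 + d)) (t : 'cV[R]_d) p q :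
  p <= 0 -> - p * d%:R <= q -> psd (lift_mx z (hvec 0 t) p q).
Proof.
move=> p0 pq v.
have R1 (u : 'cV[R]_(1 + d)) : (v^T *m (u *m u^T) *m v) 0 0 = ((u^T *m v) 0 0) ^+ 2.
  by rewrite mulmxA -mulmxA mxE big_ord1 expr2 [X in X * _]dotC.
rewrite /lift_mx !mulmxDr !mulmxDl -!scalemxAr -!scalemxAl.
have addE (A B C : 'M[R]_1) :
  (A + p *: B + q *: C) 0 0 = A 0 0 + p * B 0 0 + q * C 0 0 by rewrite !mxE.
rewrite addE !R1.
set w := fun i => t i 0 * v (rshift 1 i) 0.
have -> : ((hvec 0 t)^T *m v) 0 0 = \sum_i w i.
  rewrite dot_split hvecE0 mul0r add0r.
  by apply: eq_bigr => i _; rewrite hvecES.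
have -> : (v^T *m diag_mx (\row_k hvec 0 t k 0 ^+ 2) *m v) 0 0 = \sum_i w i ^+ 2.
  rewrite mul_mx_diag mxE big_split_ord /= big_ord1.
  rewrite mxE [(\row_k _) _ _]mxE hvecE0 expr0n mulr0 mul0r add0r.
  apply: eq_bigr => i _; rewrite mxE [v^T _ _]mxE [(\row_k _) _ _]mxE.
  by rewrite hvecES /w; ring.
rewrite -addrA addr_ge0 ?sqr_ge0 //.
have := sqr_sum_le w; have : 0 <= \sum_i w i ^+ 2.
  by apply: sumr_ge0 => i _; exact: sqr_ge0.
move: (\sum_i w i) (\sum_i w i ^+ 2) => W S S0 WS.
have h1 : - p * W ^+ 2 <= - p * (d%:R * S) by rewrite ler_wpM2l // oppr_ge0.
have h2 : - p * d%:R * S <= q * S by rewrite ler_wpM2r.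
by move: h1 h2; rewrite mulrA => h1 h2; lra.
Qed.

(** The bound on (a - b) d, multiplied by a, is the condition of [lift_mx_psd]. The equation for [g]
    says that at the other free coordinates the columns Y e_i and Y (e_0 - e_i) add up to [a]. *)
Lemma Nplus_lift (R : realType) d (C : set 'cV[R]_(1 + d)) (S0 S1 : {set 'I_d})
    (a b g : R) (j : 'I_d) :
  j \notin S0 -> j \notin S1 -> (forall i, i \in S0 -> i \in S1 = false) ->
  0 <= a <= 1 -> b <= a -> (a - b) * d%:R <= 1 - b ->
  a * b + (1 - a) * g = a ->
  (forall i, i \notin S0 -> i \notin S1 -> C (hvec 1 (pts S0 (i |: S1) b))) ->
  (forall i, i \notin S0 -> i \notin S1 -> C (hvec 1 (pts (i |: S0) S1 g))) ->
  Nplus C (hvec 1 (pts S0 S1 a)).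
Proof.
move=> j0 j1 i0N1 /andP[a0 a1] ba abd abg Cb Cg.
pose z := hvec 1 (pts S0 S1 a).
pose Y := lift_mx z (hvec 0 (ind R S0 S1)) (a * (b - a)) (a * (1 - b)).
have Y0 : col (lshift d 0) Y = z.
  apply/matrixP => k l; rewrite ord1 mxE lift_mxE !hvecE0.
  by case: eqP => [->|_]; rewrite ?hvecE0 /=; ring.
have Yd : diagc Y = z.
  apply/matrixP => k l; rewrite ord1 mxE lift_mxE eqxx.
  case: (split_ordP k) => i ->; first by rewrite !hvecE0; ring.
  by rewrite !hvecES ptsE indE; case: (i \in S1); case: (i \in S0) => /=; ring.
have YE k i : col (rshift 1 i) Y k 0 =
  z k 0 * pts S0 S1 a i 0 + a * (b - a) * (hvec 0 (ind R S0 S1) k 0 * ind R S0 S1 i 0)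
  + a * (1 - b) * (ind R S0 S1 i 0 ^+ 2 *+ (k == rshift 1 i)).
  rewrite mxE lift_mxE !hvecES; congr (_ + _ * _).
  by case: eqP => // ->; rewrite hvecES.
have Y1 i : i \in S1 -> col (rshift 1 i) Y = z.
  move=> i1; apply/matrixP => k l; rewrite ord1 YE ptsE indE i1 /= expr0n mul0rn.
  by ring.
have YS0 i : i \in S0 -> col (rshift 1 i) Y = 0.
  move=> i0; apply/matrixP => k l; rewrite ord1 YE ptsE indE i0 i0N1 //= expr0n mul0rn.
  by rewrite [RHS]mxE; ring.
have Yb i : i \notin S0 -> i \notin S1 ->
    col (rshift 1 i) Y = a *: hvec 1 (pts S0 (i |: S1) b).
  move=> i0 i1; apply/matrixP => k l; rewrite ord1 YE ptsE indE i0 i1 /= [RHS]mxE.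
  rewrite (negPf i0) (negPf i1).
  case: (split_ordP k) => m ->; first by rewrite !hvecE0 eq_lrshift /=; ring.
  rewrite !hvecES !ptsE indE eq_rshift !inE.
  case: (m =P i) => [->|_]; first by rewrite (negPf i0) (negPf i1) /=; ring.
  by case: (m \in S1); case: (m \in S0) => /=; ring.
have Yg i : i \notin S0 -> i \notin S1 ->
    z - col (rshift 1 i) Y = (1 - a) *: hvec 1 (pts (i |: S0) S1 g).
  move=> i0 i1; rewrite Yb //; apply/matrixP => k l.
  rewrite ord1 mxE [X in _ + X]mxE [X in _ - X]mxE [RHS]mxE.
  case: (split_ordP k) => m ->; first by rewrite !hvecE0; ring.
  rewrite !hvecES !ptsE !inE.
  case: (m =P i) => [->|_]; first by rewrite (negPf i0) (negPf i1) /=; ring.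
  by case: (m \in S1); case: (m \in S0) => /=; lra.
have CB i : i \notin S0 -> i \notin S1 -> dual (dual C) (col (rshift 1 i) Y).
  by move=> i0 i1; rewrite Yb //; apply: dualZ => //; apply: dual_dual; apply: Cb.
have CG i : i \notin S0 -> i \notin S1 -> dual (dual C) (z - col (rshift 1 i) Y).
  move=> i0 i1; rewrite Yg //; apply: dualZ; first by rewrite subr_ge0.
  by apply: dual_dual; apply: Cg.
(* The free coordinate [j] puts z = Y e_j + (z - Y e_j) in the bidual; this covers column 0 and the
   columns of [S0] and [S1]. *)
have Cz : dual (dual C) z.
  by have := dualD (CB j j0 j1) (CG j j0 j1); rewrite addrC subrK.
have C0 : dual (dual C) 0.
  by rewrite -(scale0r z); apply: dualZ.
exists Y; last exact: Yd; split.
  apply: M_intro => [||k|k]; first exact: lift_mx_sym.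
  - by rewrite Y0 Yd.
  - case: (split_ordP k) => i ->; first by rewrite ord1 Y0.
    case i1: (i \in S1); first by rewrite Y1.
    case i0: (i \in S0); first by rewrite YS0.
    by apply: CB; rewrite ?i0 ?i1.
  - rewrite Y0; case: (split_ordP k) => i ->; first by rewrite ord1 Y0 subrr.
    case i1: (i \in S1); first by rewrite Y1 // subrr.
    case i0: (i \in S0); first by rewrite YS0 // subr0.
    by apply: CG; rewrite ?i0 ?i1.
apply: lift_mx_psd; first by rewrite mulr_ge0_le0 // subr_le0.
by rewrite -mulrN opprB -mulrA ler_wpM2l.
Qed.

(** * The value c(0,0,s) and points of K *)

(* The value of c(0,0,s) when d = 2h. *)
Definition c00 (R : realType) (h s : nat) : R := (h%:R - s%:R) / (h%:R + 1 - s%:R).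

Lemma c00E (R : realType) h s : (s <= h)%N -> c00 R h s = 1 - ((h - s).+1%:R)^-1.
Proof.
move=> sh; rewrite /c00 -addrAC -natrB // natr1.
rewrite -[X in X / _](addrK 1) natr1 mulrBl mul1r divff // pnatr_eq0 //.
Qed.

Lemma c00_ge0 (R : realType) h s : (s <= h)%N -> 0 <= c00 R h s.
Proof. by move=> sh; rewrite c00E // subr_ge0 invf_le1 ?ltr0n // ler1n. Qed.

Lemma c00_lt1 (R : realType) h s : (s <= h)%N -> c00 R h s < 1.
Proof. by move=> sh; rewrite c00E // ltrBlDr ltrDl invr_gt0 ltr0n. Qed.

Lemma c00_anti (R : realType) h s s' : (s' <= h)%N -> (s < s')%N -> c00 R h s' < c00 R h s.
Proof.
move=> sh ss; have ? : (s <= h)%N by apply: leq_trans sh; exact: ltnW.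
rewrite !c00E // ltrD2l ltrN2 ltf_pV2 ?posrE ?ltr0n // ltr_nat ltnS.
by rewrite ltn_sub2l // (leq_trans ss).
Qed.

(** If S meets [S1] in k points, its sum is at most (h + 1) a + k (1 - a), which is <= h iff (1 - a)
    (h + 1 - k) >= 1. The worst case k = #|S1| is the hypothesis on [a]. *)
Lemma K_pts (R : realType) d (S0 S1 : {set 'I_d}) (a : R) :
  (#|S1| <= d./2)%N -> 0 <= a <= c00 R d./2 #|S1| -> K (hvec 1 (pts S0 S1 a)).
Proof.
move=> S1h /andP[a0 aq]; exists 1, (pts S0 S1 a).
have a1 : a <= 1 by apply: le_trans aq (ltW (c00_lt1 _ S1h)).
split=> // [S SC|i]; last first.
  by rewrite mxE; case: ifP => _; [|case: ifP => _]; rewrite ?lexx ?ler01 ?a0.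
rewrite mulr1; set h := d./2 in S1h SC aq *.
apply: (@le_trans _ _ (\sum_(i in S) (a + (i \in S1)%:R * (1 - a)))).
  apply: ler_sum => i _; rewrite mxE; case: (i \in S1); first by rewrite mul1r addrC subrK.
  by rewrite mul0r addr0; case: ifP.
rewrite big_split /= sumr_const SC -mulr_suml.
have -> : \sum_(i in S) (i \in S1)%:R = #|S :&: S1|%:R :> R.
  rewrite -sum1_card natr_sum big_mkcond [RHS]big_mkcond.
  by apply: eq_bigr => i _; rewrite inE; do 2!case: (_ \in _).
set k := #|S :&: S1|; have kS1 : (k <= #|S1|)%N by apply: subset_leq_card; exact: subsetIr.
have m0 : (0 : R) < (h - #|S1|).+1%:R by rewrite ltr0n.
move: aq; rewrite c00E // -[a *+ _]mulr_natr => aq.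
have e : (1 - a) * (h - #|S1|).+1%:R >= 1.
  by rewrite -ler_pdivrMr // div1r lerBrDl -lerBrDr.
have : (1 - a) * (h - #|S1|).+1%:R <= (1 - a) * (h.+1 - k)%:R.
  rewrite ler_wpM2l ?subr_ge0 // ler_nat -subSn // leq_sub2l //.
rewrite natrB ?(leq_trans kS1) ?(leq_trans S1h) // -natr1; lra.
Qed.

(** * Attainment for c and c_+, the induction on r, and the comparison *)

Lemma c_spec (R : realType) d r n0 n1 : (n1 + n0 < d)%N ->
  let A := [set a | iter r (@N R d) (@K R d) (hvec 1 (pt d n0 n1 a))] in
  A !=set0 -> A (c R d r n0 n1) /\ ubound A (c R d r n0 n1).
Proof.
move=> nd A A0; apply: largestP; case: r @A A0 => [|r] A A0.
  exact: K_has_largest.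
have -> : [set a | iter r.+1 (@N R d) (@K R d) (hvec 1 (pt d n0 n1 a))] =
    [set a | [set diagc Y | Y in M (iter r (@N R d) (@K R d)) `&` setT]
      (hvec 1 (pt d n0 n1 a))] by rewrite setIT.
apply: M_slice_has_largest => //; last by rewrite setIT.
  by apply: iter_N_box; apply: leq_ltn_trans nd.
Qed.

Lemma cplus_spec (R : realType) d r n0 n1 : (n1 + n0 < d)%N ->
  let A := [set a | iter r (@Nplus R d) (@K R d) (hvec 1 (pt d n0 n1 a))] in
  A !=set0 -> A (cplus R d r n0 n1) /\ ubound A (cplus R d r n0 n1).
Proof.
move=> nd A A0; apply: largestP; case: r @A A0 => [|r] A A0.
  exact: K_has_largest.
apply: (M_slice_has_largest (C := iter r (@Nplus R d) (@K R d))
  (P := @psd R (1 + d))) => //.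
  by apply: iter_Nplus_box; apply: leq_ltn_trans nd.
exact: closed_psd.
Qed.

Lemma card_lt_ord d m : (m <= d)%N -> #|[set i : 'I_d | (i < m)%N]%SET| = m.
Proof.
by move=> md; rewrite -sum1dep_card -(big_ord_widen d (fun=> 1%N)) // sum1_card card_ord.
Qed.

Lemma pt_pts (R : realType) d n0 n1 : (n1 + n0 <= d)%N ->
  exists S0 S1 : {set 'I_d}, [/\ #|S0| = n0, #|S1| = n1,
    forall i, i \in S0 -> i \in S1 = false & forall a : R, pt d n0 n1 a = pts S0 S1 a].
Proof.
move=> nd; pose S m := [set i : 'I_d | (i < m)%N]%SET.
have n1d : (n1 <= d)%N by apply: leq_trans nd; exact: leq_addr.
exists (S (n1 + n0)%N :\: S n1)%SET, (S n1); split.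
- rewrite cardsD (finset.setIidPr _) ?card_lt_ord ?addKn //.
  by apply/fintype.subsetP => i; rewrite !inE => /leq_trans; apply; exact: leq_addr.
- exact: card_lt_ord.
- by move=> i; rewrite !inE => /andP[/negPf].
- move=> a; apply/matrixP => i j; rewrite !mxE !inE.
  by case: (i < n1)%N.
Qed.

(** The bound [a0] is chosen before the sets, so that one bound serves all coordinates fixed in the
    next step. A whole interval is claimed because the value g there varies with a. *)
Lemma Nplus_iter_pts (R : realType) d r : (2 <= d)%N -> forall n0 n1,
  (r + n0 + n1 <= d./2)%N ->
  exists a0 : R, [/\ c00 R d./2 (r + n0 + n1) <= a0,
    (0 < r + n0)%N -> c00 R d./2 (r + n0 + n1) < a0 &
    forall S0 S1 : {set 'I_d}, (forall i, i \in S0 -> i \in S1 = false) ->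
    #|S0| = n0 -> #|S1| = n1 ->
    forall a, c00 R d./2 (r + n0 + n1) <= a <= a0 ->
    iter r (@Nplus R d) (@K R d) (hvec 1 (pts S0 S1 a))].
Proof.
move=> d2; elim: r => [|r IH] n0 n1 sh.
  (* For r = 0 zeros do not tighten the constraint, so c(0,0,n1) is reached; it exceeds c(0,0,n0+n1)
     as soon as n0 > 0. *)
  exists (c00 R d./2 n1); rewrite add0n in sh *.
  have qlt : (0 < n0)%N -> c00 R d./2 (n0 + n1) < c00 R d./2 n1.
    by move=> n00; apply: c00_anti => //; rewrite -[ltnLHS]add0n ltn_add2r.
  split=> // [|S0 S1 _ _ S1n a /andP[aq qa]].
    by case: (posnP n0) => [->|/qlt/ltW].
  by apply: K_pts; rewrite S1n ?qa ?(leq_trans _ sh) ?leq_addl // (le_trans _ aq) ?c00_ge0.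
have [a1 [a1q _ Ka1]] := IH n0 n1.+1 ltac:(by rewrite addnS -!addSn).
have [a2 [_ /(_ ltac:(by rewrite addnS)) a2q Ka2]] :=
  IH n0.+1 n1 ltac:(by rewrite addnS -!addSn).
rewrite [(r + n0 + n1.+1)%N]addnS -!addSn in a1q Ka1.
rewrite [(r + n0.+1)%N]addnS -!addSn in a2q Ka2.
set b := c00 R d./2 (r.+1 + n0 + n1) in a1q Ka1 a2q Ka2 *.
have b0 : 0 <= b by exact: c00_ge0.
have b1 : b < 1 by exact: c00_lt1.
have dR : 2 <= d%:R :> R by rewrite (ler_nat _ 2).
have dR0 : 0 < d%:R :> R by lra.
have den : 0 < 1 - b + a2 by lra.
(* The first bound is g <= a2 solved for a, and exceeds b because (1 - b) (a2 - b) > 0. The second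
   is the positive semidefiniteness condition. *)
have ba0 : b < Num.min (a2 / (1 - b + a2)) (b + (1 - b) / d%:R).
  rewrite lt_min ltr_pdivlMr // ltrDl divr_gt0 ?subr_gt0 // andbT.
  have : 0 < (1 - b) * (a2 - b) by rewrite mulr_gt0 ?subr_gt0.
  by lra.
exists (Num.min (a2 / (1 - b + a2)) (b + (1 - b) / d%:R)); split=> //.
  exact: ltW.
move=> S0 S1 S01 S0n S1n a /andP[ab]; rewrite le_min ler_pdivlMr // -lerBlDl.
rewrite ler_pdivlMr // => /andP[aa2 abd].
(* As d >= 2, a is at most the midpoint of b and 1, so the denominator of g is positive. *)
have a1' : a < 1.
  have : (a - b) * 2 <= 1 - b by apply: le_trans abd; rewrite ler_wpM2l ?subr_ge0.
  by lra.
have [j] : exists j, j \notin S0 :|: S1.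
  apply/existsP; rewrite -[[exists _, _]]negbK negb_exists; apply/negP => /forallP SU.
  have : (d <= #|S0 :|: S1|)%N.
    rewrite -{1}(card_ord d) -cardsT subset_leq_card //.
    by apply/fintype.subsetP => i _; have := SU i; rewrite negbK.
  apply/negP; rewrite -ltnNge (leq_ltn_trans (leq_card_setU _ _)) // S0n S1n.
  apply: (@leq_ltn_trans d./2).
    by apply: leq_trans sh; rewrite -addnA leq_addl.
  by rewrite -divn2 ltn_Pdiv // (leq_trans _ d2).
rewrite !inE negb_or => /andP[j0 j1].
have g_def : a * b + (1 - a) * (a * (1 - b) / (1 - a)) = a.
  by field; rewrite subr_eq0 gt_eqF.
rewrite iterS; apply: (Nplus_lift j0 j1 S01 _ ab abd g_def).
- by rewrite (le_trans b0 ab) ltW.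
(* Only the left endpoint b of this interval is used, so b <= a1 need not be strict. *)
- move=> i i0 i1; apply: Ka1; rewrite ?lexx ?a1q //.
    by move=> k k0; rewrite !inE S01 // orbF; apply: contraNF i0 => /eqP <-.
  by rewrite cardsU1 i1 S1n.
- move=> i i0 i1; apply: Ka2.
  + by move=> k; rewrite !inE => /orP[/eqP ->|/S01//]; apply/negbTE.
  + by rewrite cardsU1 i0 S0n.
  + exact: S1n.
  + rewrite ler_pdivlMr ?subr_gt0 // ler_pdivrMr ?subr_gt0 //.
    by apply/andP; split; lra.
Qed.

(** The upper bound tests the set of the first h + 1 coordinates, h = d/2: it contains all s ones,
    giving s + (h + 1 - s) a <= h. *)
Lemma c_c00 (R : realType) d s : (2 <= d)%N -> (s <= d./2)%N ->
  c R d 0 0 s = c00 R d./2 s.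
Proof.
move=> d2 sh.
have hd : (d./2 < d)%N by rewrite -divn2 ltn_Pdiv // (leq_trans _ d2).
have [S0 [S1 [S0n S1n S01 E]]] : exists S0 S1 : {set 'I_d}, [/\ #|S0| = 0%N, #|S1| = s,
    forall i, i \in S0 -> i \in S1 = false & forall a : R, pt d 0 s a = pts S0 S1 a].
  by apply: pt_pts; rewrite addn0 (leq_trans sh) // ltnW.
apply: largest_eq => /= [|a /K_hvecE[/(_ [set i : 'I_d | (i < d./2.+1)%N]%SET)]].
  by rewrite E; apply: K_pts; rewrite S1n // lexx c00_ge0.
rewrite card_lt_ord // mulr1 => /(_ erefl).
rewrite (_ : \sum_(i in _) _ = s%:R + (d./2.+1 - s)%:R * a); last first.
  rewrite (eq_bigl (fun i : 'I_d => (i < d./2.+1)%N)); last by move=> i; rewrite inE.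
  pose F i : R := if (i < s)%N then 1 else a.
  rewrite (eq_bigr (fun i : 'I_d => F i)); last first.
    by move=> i _; rewrite mxE addn0 /F; case: (i < s)%N.
  rewrite -(big_ord_widen d F) // -(big_mkord xpredT F).
  rewrite (big_cat_nat (n := s)) //=; last exact: leqW.
  rewrite (eq_big_nat _ _ (F2 := fun=> 1)); last by move=> i /andP[_ i1]; rewrite /F i1.
  rewrite [X in _ + X](eq_big_nat _ _ (F2 := fun=> a)); last first.
    by move=> i /andP[i1 _]; rewrite /F ltnNge i1.
  by rewrite !sumr_const_nat subn0 mulr_natl.
move=> + _; rewrite /c00 ler_pdivlMr; last by rewrite subr_gt0 natr1 ltr_nat ltnS.
by rewrite natrB ?leqW // -natr1; lra.
Qed.

(* For r = n0 = 0 the quantities cplus 0 0 n1 and c 0 0 s coincide, N^0 and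
   N_+^0 being the identity, so the strict inequality is asserted exactly when
   r + n0 > 0; in the final clause this excludes only d = 2. *)
Theorem theoremA3 (R : realType) (d : nat) (hd2 : (2 <= d)%N)
    (hde : ~~ odd d) :
  (forall r n0 n1 : nat, (r + n0 + n1 <= d./2)%N ->
     let s := (r + n0 + n1)%N in
     [/\ c R d r n0 n1 >= cplus R d r n0 n1,
         cplus R d r n0 n1 >= c R d 0 0 s,
         ((0 < r + n0)%N -> cplus R d r n0 n1 > c R d 0 0 s) &
         c R d 0 0 s = ((d./2)%:R - s%:R) / ((d./2)%:R + 1 - s%:R)])
  /\ ((2 < d)%N -> cplus R d (d./2).-1 0 0 > 1 / 2).
Proof.
have hd : (d./2 < d)%N by rewrite -divn2 ltn_Pdiv // (leq_trans _ hd2).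
have main r n0 n1 : (r + n0 + n1 <= d./2)%N ->
    let s := (r + n0 + n1)%N in
    [/\ c R d r n0 n1 >= cplus R d r n0 n1, cplus R d r n0 n1 >= c00 R d./2 s &
        (0 < r + n0)%N -> cplus R d r n0 n1 > c00 R d./2 s].
  move=> sh s.
  have nd : (n1 + n0 < d)%N.
    by apply: leq_ltn_trans hd; rewrite addnC (leq_trans _ sh) // -addnA leq_addl.
  (* [a0] is admissible, so the sets defining c_+ and c are nonempty, the default value of [largest]
     is excluded, and c_+ >= a0. *)
  have [a0 [a0q a0q' Ka0]] := Nplus_iter_pts R hd2 sh.
  have [S0 [S1 [S0n S1n S01 E]]] := pt_pts R (ltnW nd).
  have a0A : iter r (@Nplus R d) (@K R d) (hvec 1 (pt d n0 n1 a0)).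
    by rewrite E; apply: Ka0; rewrite ?a0q ?lexx.
  have [cpA cpU] := cplus_spec nd (ex_intro _ a0 a0A).
  have [_ cU] := c_spec nd (ex_intro _ a0 (iter_Nplus_sub a0A)).
  split; first by apply: cU; exact: iter_Nplus_sub.
    by apply: le_trans a0q _; exact: cpU.
  by move=> /a0q' a0q''; apply: lt_le_trans a0q'' _; exact: cpU.
split=> [r n0 n1 sh s|d3].
  have [h1 h2 h3] := main r n0 n1 sh.
  by split; rewrite ?c_c00.
(* Makes r = d/2 - 1 positive, so the strict inequality applies; there s = d/2 - 1 and c(0,0,s) = 1
   - 1/2. *)
have h2 : (1 < d./2)%N.
  by case: d hde d3 {hd2 hd main} => [|[|[|[|d]]]].
have e : (d./2.-1 + 0 + 0 = d./2.-1)%N by rewrite !addn0.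
have [|_ _] := main (d./2.-1) 0%N 0%N; first by rewrite e leq_pred.
rewrite e addn0 -ltnS prednK ?(ltnW h2) // => /(_ h2).
have e1 : (d./2 - d./2.-1 = 1)%N by rewrite -{1}(prednK (ltnW h2)) subSnn.
by rewrite c00E ?leq_pred // e1 (_ : 1 - 2^-1 = 1 / 2 :> R) //; lra.
Qed.
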